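(* Let $X$ be a Banach space and $G$ a compact topological group acting on $X$. If $X^*$ is $G$-strongly subdifferentiable ($G$-SSD), then the set $\mathrm{NA}(X)$ of norm-attaining functionals on $X$ contains the vector space $X_G^*$.
   Context: $X$ is a Banach space over $\mathbb{K}=\mathbb{R}$ or $\mathbb{C}$. A compact topological group $G$ acting on $X$ means: a group $G\subseteq\mathcal{L}(X)$ of linear isometric isomorphisms of $X$ onto itself, compact for the relative topology inherited from $\mathcal{L}(X)$. $X_G^*=\{f\in X^*: f(g(x))=f(x)\ \forall x\in X, g\in G\}$. $\mathrm{NA}(X)$ is the set of $f\in X^*$ for which there is $x\in X$ with $\|x\|=1$ and $f(x)=\|f\|$. $X^*$ is $G$-SSD (with respect to the dual group $G^*=\{g^*: g\in G\}$) if for every $u\in X_G^*$ with $\|u\|=1$ the limit $\lim_{t\to0^+}\frac{\|u+tz\|-1}{t}$ exists uniformly for $z$ in the closed unit ball of $X_G^*$. *)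

(* Defs.v *)
From mathcomp Require Import all_boot all_order all_algebra.
From mathcomp Require Import complex.
From mathcomp Require Import all_classical all_reals all_analysis.
Import Order.TTheory GRing.Theory Num.Theory.
Import numFieldNormedType.Exports.

Set Implicit Arguments.
Unset Strict Implicit.
Unset Printing Implicit Defensive.

Local Open Scope classical_set_scope.
Local Open Scope ring_scope.

(* [K] is an arbitrary [numFieldType] here, but is only meant to
   be a [realType] [R] or the field [R[i]] of complex numbers. As usual in
   MathComp-Analysis norms take their values in [K]; when [K] is [R[i]] these
   values are nonnegative reals, and [0 < t] says that [t] is real and
   positive. *)

Section Defs.
Variables (K : numFieldType) (X : normedModType K).

Definition unit_ball : set X := [set x | `|x| <= 1].

Definition dual_space : set (X -> K^o) := [set f | linear f /\ continuous f].

(* The least upper bound is taken for the partial order of [K]: upper bounds of a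
   nonempty set of nonnegative elements are real, so over [R[i]] this is the
   usual real supremum (see [complex_dual_norm_lub] below). *)
Definition dual_norm (f : X -> K^o) : K :=
  supremum 0 [set `|f x| | x in unit_ball].

Definition isometric_isomorphism (g : X -> X) : Prop :=
  [/\ linear g, (forall x, `|g x| = `|x|) & range g = setT].

(* The topology of bounded operators given by the operator norm is that of
   uniform convergence on the unit ball (see [nbhs_uniform_unit_ball] below).
   Compactness of [G] only depends on the topology induced on [G], hence may be
   stated in the space of all functions. *)
Definition compact_isometry_group (G : set (X -> X)) : Prop :=
  [/\ G `<=` isometric_isomorphism,
      G id,
      (forall g h, G g -> G h -> G (g \o h)),
      (forall g, G g -> exists2 h, G h & cancel g h /\ cancel h g) &
      compact (G : set {uniform` unit_ball -> X})].

Definition invariant_dual (G : set (X -> X)) : set (X -> K^o) :=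
  [set f | dual_space f /\ forall g x, G g -> f (g x) = f x].

Definition norm_attaining : set (X -> K^o) :=
  [set f | dual_space f /\ exists x : X, `|x| = 1 /\ f x = dual_norm f].

Definition invariant_dual_ball (G : set (X -> X)) : set (X -> K^o) :=
  [set z | invariant_dual G z /\ dual_norm z <= 1].

Definition dual_G_SSD (G : set (X -> X)) : Prop :=
  forall u : X -> K^o, invariant_dual G u -> dual_norm u = 1 ->
  exists l : (X -> K^o) -> K^o,
    {uniform invariant_dual_ball G,
      (fun (t : K) (z : X -> K^o) => (dual_norm (u + t *: z) - 1) / t : K^o)
        @ 0^'+ --> l}.

End Defs.

Lemma nbhs_uniform_unit_ball (K : numFieldType) (X : normedModType K)
    (g : X -> X) (P : set (X -> X)) :
  nbhs (g : {uniform` @unit_ball K X -> X}) P <->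
  exists2 e : K, 0 < e &
    [set h | forall x, unit_ball x -> `|g x - h x| < e] `<=` P.
Proof.
rewrite uniform_nbhs; split.
- move=> [E [entE EP]].
  move: entE; rewrite -entourage_ballE => -[e /= e0 eE].
  exists e => // h gh; apply: EP => x /= xb; apply: eE => /=.
  by rewrite -ball_normE /=; exact: gh.
- move=> [e e0 eP]; exists [set xy : X * X | ball xy.1 e xy.2]; split.
    by rewrite -entourage_ballE; exists e.
  by move=> h gh; apply: eP => x xb /=; have := gh x xb; rewrite -ball_normE.
Qed.

Lemma complex_dual_norm_lub (R : realType) (X : normedModType R[i]) (f : X -> R[i]^o) :
  (exists M : R[i], forall x, unit_ball x -> `|f x| <= M) -> f 0 = 0 ->
  supremums [set `|f x| | x in @unit_ball R[i] X] (dual_norm f).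
Proof.
move=> [M hM] f0; rewrite /dual_norm /supremum.
set A := [set `|f x| | x in _].
have A0 : A (`|f 0|) by exists 0 => //; rewrite /unit_ball /= normr0 ler01.
case: eqP => [E|_]; first by rewrite E in A0.
have Areal z : A z -> z = ((complex.Re z)%:C)%C.
  by move=> [x _ <-]; apply/eqP; rewrite eq_complex /= eqxx /=; case: (f x).
have hs : has_sup [set complex.Re z | z in A].
  split; first by exists (complex.Re `|f 0|); exists `|f 0|.
  exists (complex.Re M) => _ [_ [x xb <-] <-].
  have := hM x xb; rewrite lecE => /andP[]//.
case: xgetP => [s ->//|H]; exfalso.
apply: (H ((sup [set complex.Re z | z in A])%:C)%C); split.
- move=> z Az; rewrite (Areal _ Az) lecE /= eqxx /=.
  by apply: ub_le_sup; [case: hs|exists z].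
- move=> b bA; rewrite lecE /=.
  have := bA _ A0; rewrite (Areal _ A0) lecE /= => /andP[-> _] /=.
  apply: ge_sup; first by case: hs.
  by move=> _ [z Az <-]; have := bA _ Az; rewrite lecE => /andP[].
Qed.

(* Main.v *)
(* By averaging over [G] one gets a norm-one projection [Q] of [X] with [Q g = Q]
   for [g] in [G] and [u Q = u] for [u] invariant. No Haar measure is needed: a
   product of averages over finer and finer finite nets of [G] converges in
   operator norm.

   Let [u] be invariant of norm one. A point [x] with [||Q x|| <= 1] and [u x]
   close to [1] can be moved by at most [e], for the seminorm [||Q x||], so as to
   make [u x] as close to [1] as desired. Otherwise Hahn-Banach separates [x],
   for this seminorm, from the slice [{c | ||Q c|| <= 1, u c >= 1 - d'}] by an
   invariant [z] with [z c <= z x - e] on the slice: the derivative of the dual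
   norm at [u] in the direction [z] is then at most [z x - e], whereas
   [||u + t z|| >= u x + t z x], and this contradicts the uniformity of the limit.
   Iterating such moves gives a Cauchy sequence, at whose limit [u] attains its
   norm. *)

Require Import Defs.
From HB Require Import structures.
From mathcomp Require Import all_boot all_order all_algebra finmap.
From mathcomp Require Import complex ring lra.
From mathcomp Require Import all_classical all_reals all_analysis.
Import Order.TTheory GRing.Theory Num.Theory.
Import numFieldNormedType.Exports.

Set Implicit Arguments.
Unset Strict Implicit.
Unset Printing Implicit Defensive.

Local Open Scope classical_set_scope.
Local Open Scope ring_scope.

(** * Hahn-Banach for sublinear functionals *)

Section HahnBanach.
Variables (R : realType) (V : lmodType R).

Definition sublinear (p : V -> R) :=
  (forall x y, p (x + y) <= p x + p y) /\
  (forall t x, 0 < t -> p (t *: x) = t * p x).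

Lemma sublinear0 (p : V -> R) : sublinear p -> p 0 = 0.
Proof.
move=> [_ /(_ 2 0 (ltr0Sn _ _))]; rewrite scaler0.
by move=> h; lra.
Qed.

Lemma sublinear_oppr (p : V -> R) (x : V) : sublinear p -> - p (- x) <= p x.
Proof.
move=> sp; have := sp.1 x (- x); rewrite subrr (sublinear0 sp) => h.
by rewrite lerNl -subr_ge0 opprK addrC.
Qed.

(** Common source of the sublinear functionals used below: the one testing minimality, the infimum
    of a chain and the separating functional. Values need only add up to an inequality, so for a
    chain the smaller of two comparable functionals can serve for both. Homogeneity follows from one
    inequality, applied to [t] and to [t^-1]. *)
Lemma sublinear_inf (S : V -> set R) :
  (forall x, has_inf (S x)) ->
  (forall x y a b, S x a -> S y b -> exists2 c, S (x + y) c & c <= a + b) ->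
  (forall t x a, 0 < t -> S x a -> S (t *: x) (t * a)) ->
  sublinear (fun x => inf (S x)).
Proof.
move=> infS SD SZ.
have infZ t x : 0 < t -> inf (S (t *: x)) <= t * inf (S x).
  move=> t0; rewrite mulrC -ler_pdivrMr//; apply: lb_le_inf; first exact: (infS x).1.
  move=> a Sa; rewrite ler_pdivrMr// mulrC; apply: ge_inf; first exact: (infS _).2.
  exact: SZ.
split=> [x y|t x t0].
- apply/ler_addgt0Pl => e e0; have e20 : 0 < e / 2 by lra.
  have [a Sa ae] := inf_adherent e20 (infS x).
  have [b Sb be] := inf_adherent e20 (infS y).
  have [c Sc cab] := SD _ _ _ _ Sa Sb.
  have := @ge_inf _ _ (infS (x + y)).2 _ Sc; lra.
- apply/eqP; rewrite eq_le infZ //=.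
  rewrite -ler_pdivlMl//; have := infZ t^-1 (t *: x).
  by rewrite scalerA mulVf ?gt_eqF// scale1r; apply; rewrite invr_gt0.
Qed.

(* By minimality [q] agrees with [x |-> inf_(t >= 0) (q (x + t y) - t q y)], and
   [t = 1] gives [q x + q y <= q (x + y)]. *)
Lemma minimal_sublinear_linear (q : V -> R) : sublinear q ->
  (forall r, sublinear r -> (forall x, r x <= q x) -> forall x, q x <= r x) ->
  (forall x y, q (x + y) = q x + q y) /\ (forall t x, q (t *: x) = t * q x).
Proof.
move=> sq qmin.
have qD x y : q (x + y) = q x + q y.
  apply/eqP; rewrite eq_le sq.1 /= -lerBrDr.
  pose S v := [set q (v + t *: y) - t * q y | t in [set t : R | 0 <= t]].
  have infS v : has_inf (S v).
    split; first by exists (q (v + 0 *: y) - 0 * q y); exists 0 => /=.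
    exists (- q (- v)) => _ [t /= t0 <-].
    have [->|tn0] := eqVneq t 0.
      by rewrite scale0r addr0 mul0r subr0; apply: sublinear_oppr.
    rewrite -sq.2 ?lt_def ?tn0//.
    have := sq.1 (v + t *: y) (- v); rewrite addrAC subrr add0r; lra.
  have Sle v : inf (S v) <= q v.
    apply: ge_inf; first exact: (infS v).2.
    by exists 0; rewrite //= scale0r addr0 mul0r subr0.
  apply: le_trans (qmin (fun v => inf (S v)) _ Sle x) _.
  - apply: sublinear_inf => //.
    + move=> v w _ _ [s /= s0 <-] [t /= t0 <-].
      exists (q ((v + w) + (s + t) *: y) - (s + t) * q y).
        by exists (s + t) => //=; rewrite addr_ge0.
      by rewrite scalerDl addrACA mulrDl; have := sq.1 (v + s *: y) (w + t *: y); lra.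
    + move=> s v _ s0 [t /= t0 <-]; exists (s * t) => /=; first by rewrite mulr_ge0 // ltW.
      by rewrite -scalerA -scalerDr sq.2// mulrBr mulrA.
  - apply: ge_inf; first exact: (infS x).2.
    by exists 1; rewrite //= scale1r mul1r.
have q0 := sublinear0 sq.
have qN x : q (- x) = - q x.
  by apply/eqP; rewrite -addr_eq0 addrC -qD subrr q0.
split=> // t x; have [t0|t0|->] := ltgtP t 0; last by rewrite scale0r mul0r q0.
- by rewrite -[in LHS](opprK t) scaleNr qN sq.2 ?oppr_gt0// mulNr opprK.
- exact: sq.2.
Qed.

(** Zorn's lemma among the sublinear functionals below [p]: the pointwise infimum of a chain is
    finite, being at least [- p (- x)], and a minimal element is linear. *)
Lemma Hahn_Banach_sublinear (p : V -> R) : sublinear p ->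
  exists z : V -> R, [/\ (forall x y, z (x + y) = z x + z y),
    (forall t x, z (t *: x) = t * z x) & (forall x, z x <= p x)].
Proof.
move=> sp; pose T := {q : V -> R | sublinear q /\ forall x, q x <= p x}.
(* The order is reversed, so that maximal elements are minimal functionals; the empty chain is
   bounded by [p] itself. *)
pose le_op (q r : T) := `[< forall x, sval r x <= sval q x >].
have p0 : T by exists p; split.
have [|||[q [sq qp]] qmax] := @ZL_preorder T p0 le_op.
- by move=> q; apply/asboolP => x.
- by move=> r q s /asboolP rq /asboolP qs; apply/asboolP => x; apply: le_trans (rq x).
- move=> A tA; have [[a Aa]|/set0P/negP/negPn/eqP A0] := pselect (A !=set0); last first.
    by exists p0 => s; rewrite A0.
  pose S x := [set sval q x | q in A].
  have infS x : has_inf (S x).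
    split; first by exists (sval a x); exists a.
    exists (- p (- x)) => _ [[r [sr rp]] _ <-] /=.
    by apply: le_trans (sublinear_oppr _ sr); rewrite lerN2.
  have Sle x r : A r -> inf (S x) <= sval r x.
    by move=> Ar; apply: ge_inf; [exact: (infS x).2|exists r].
  have sS : sublinear (fun x => inf (S x)).
    apply: sublinear_inf => //.
    + move=> x y _ _ [q Aq <-] [r Ar <-]; have [/asboolP qr|/asboolP qr] := tA q r Aq Ar.
      * exists (sval r (x + y)); first by exists r.
        by apply: le_trans ((svalP r).1.1 x y) _; rewrite lerD2r.
      * exists (sval q (x + y)); first by exists q.
        by apply: le_trans ((svalP q).1.1 x y) _; rewrite lerD2l.
    + by move=> t x _ t0 [q Aq <-]; exists q; rewrite //= (svalP q).1.2.
  have Sp x : inf (S x) <= p x by apply: le_trans (Sle _ _ Aa) ((svalP a).2 x).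
  pose i : T := exist _ (fun x => inf (S x)) (conj sS Sp).
  by exists i => r Ar; apply/asboolP => x /=; exact: Sle.
- have qmin r : sublinear r -> (forall x, r x <= q x) -> forall x, q x <= r x.
    move=> sr rq.
    have rp x : r x <= p x by apply: le_trans (rq x) (qp x).
    by have /asboolP := qmax (exist _ r (conj sr rp) : T) (introT (asboolP _) rq).
  by have [qD qZ] := minimal_sublinear_linear sq qmin; exists q.
Qed.

End HahnBanach.

(** * Real and complex scalars *)

Section LinearFunctions.
Variables (K : nzRingType) (U V : lmodType K) (f : U -> V).
Hypothesis lf : linear f.

Let f_lin : {linear U -> V} := HB.pack f (GRing.isLinear.Build K U V *:%R f lf).

Lemma lin0 : f 0 = 0. Proof. exact: (linear0 f_lin). Qed.
Lemma linD x y : f (x + y) = f x + f y. Proof. exact: (linearD f_lin). Qed.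
Lemma linN x : f (- x) = - f x. Proof. exact: (linearN f_lin). Qed.
Lemma linB x y : f (x - y) = f x - f y. Proof. exact: (linearB f_lin). Qed.
Lemma linZ k x : f (k *: x) = k *: f x. Proof. exact: (linearZ_LR f_lin). Qed.
Lemma lin_sum n (F : 'I_n -> U) : f (\sum_i F i) = \sum_i f (F i).
Proof. exact: (linear_sum f_lin). Qed.

End LinearFunctions.

Lemma comp_linear (K : nzRingType) (U V W : lmodType K) (f : V -> W) (g : U -> V) :
  linear f -> linear g -> linear (f \o g).
Proof. by move=> lf lg k x y /=; rewrite lg lf. Qed.

(** An alias, so that the module structure over [R] does not clash with the one of [V] over [K]; the
    morphism is recorded in the type because the scaling depends on it. *)
Definition restrict_scalars (R K : nzRingType) (_ : {rmorphism R -> K})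
  (V : lmodType K) : Type := V.

Section RestrictScalars.
Variables (R K : nzRingType) (f : {rmorphism R -> K}) (V : lmodType K).
Notation W := (restrict_scalars f V).

HB.instance Definition _ := GRing.Zmodule.on W.

Let scale (r : R) (v : W) : W := f r *: (v : V).

Let scaleA a b v : scale a (scale b v) = scale (a * b) v.
Proof. by rewrite /scale scalerA rmorphM. Qed.
Let scale1 : left_id 1 scale.
Proof. by move=> v; rewrite /scale rmorph1 scale1r. Qed.
Let scaleDr : right_distributive scale +%R.
Proof. by move=> a u v; rewrite /scale scalerDr. Qed.
Let scaleDl v : {morph scale^~ v : a b / a + b >-> a + b}.
Proof. by move=> a b; rewrite /scale rmorphD scalerDl. Qed.

HB.instance Definition _ :=
  GRing.Zmodule_isLmodule.Build R W scaleA scale1 scaleDr scaleDl.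

End RestrictScalars.

(* The common features of [R] and [R[i]], with [of_real] the inclusion of the reals
   and [real_part] the real part. *)
Record real_scalars (R : realType) (K : numFieldType) := RealScalars {
  of_real : {rmorphism R -> K};
  real_part : K -> R;
  reD : forall k l, real_part (k + l) = real_part k + real_part l;
  reZ : forall r k, real_part (of_real r * k) = r * real_part k;
  inj_re : forall k, 0 <= k -> of_real (real_part k) = k;
  inj_ge0 : forall r, (0 <= of_real r) = (0 <= r);
  re_le_norm : forall k, real_part k <= real_part `|k|;
  re_eq_norm : forall k, real_part k = real_part `|k| -> k = `|k|;
  re_lift : forall (V : lmodType K) (Z : V -> R),
    (forall x y, Z (x + y) = Z x + Z y) ->
    (forall r x, Z (of_real r *: x) = r * Z x) ->
    exists2 z : V -> K^o, linear z & forall x, real_part (z x) = Z x }.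

Section RealRealScalars.
Variable R : realType.

Let real_lift (V : lmodType R) (Z : V -> R) :
  (forall x y, Z (x + y) = Z x + Z y) ->
  (forall r x, Z (idfun r *: x) = r * Z x) ->
  exists2 z : V -> R^o, linear z & forall x, idfun (z x) = Z x.
Proof. by move=> ZD ZZ; exists Z => // k x y; rewrite ZD ZZ. Qed.

Definition real_real_scalars : real_scalars R R.
Proof.
apply: (@RealScalars R R idfun idfun) => // k; exact: ler_norm.
Defined.

Let Re_inj r k : complex.Re (real_complex R r * k) = r * complex.Re k.
Proof. by case: k => a b /=; rewrite mul0r subr0. Qed.

Let inj_Re (k : R[i]) : 0 <= k -> real_complex R (complex.Re k) = k.
Proof. by move=> k0; rewrite RRe_real// realE k0. Qed.

Let Re_le_norm (k : R[i]) : complex.Re k <= complex.Re `|k|.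
Proof.
rewrite -lecR (inj_Re (k := `|k|))//; apply: le_trans (normc_ge_Re k).
by rewrite lecR ler_norm.
Qed.

Let Re_eq_norm (k : R[i]) : complex.Re k = complex.Re `|k| -> k = `|k|.
Proof.
case: k => a b; rewrite normc_def /= => aE.
have ab0 : 0 <= a ^+ 2 + b ^+ 2 by rewrite addr_ge0 ?sqr_ge0.
have : a ^+ 2 = a ^+ 2 + b ^+ 2 by rewrite {1}aE sqr_sqrtr.
move=> /eqP; rewrite -subr_eq0 opprD addNKr oppr_eq0 sqrf_eq0 => /eqP b0.
by rewrite {1}aE b0.
Qed.

(** A complex linear functional is determined by its real part [Z] through [Z x - i Z (i x)]. *)
Let complex_lift (V : lmodType R[i]) (Z : V -> R) :
  (forall x y, Z (x + y) = Z x + Z y) ->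
  (forall r x, Z (real_complex R r *: x) = r * Z x) ->
  exists2 z : V -> R[i]^o, linear z & forall x, complex.Re (z x) = Z x.
Proof.
move=> ZD ZZ; exists (fun x => (Z x +i* - Z ('i%C *: x))%C) => // k x y.
have ZN v : Z (- v) = - Z v.
  have Z0 : Z 0 = 0 by have := ZD 0 0; rewrite addr0 => h; lra.
  by apply/eqP; rewrite -addr_eq0 addrC -ZD subrr Z0.
have ZC l v : Z (l *: v) = complex.Re l * Z v + complex.Im l * Z ('i%C *: v).
  by rewrite {1}[l]complexE scalerDl ZD ZZ ['i%C * _]mulrC -scalerA ZZ.
rewrite scalerDr !ZD scalerA (ZC k) (ZC (_ * k)).
case: k => a b; apply/eqP; rewrite eq_complex /= !mul0r !mul1r !sub0r !add0r.
by apply/andP; split; apply/eqP; ring.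
Qed.

Definition complex_real_scalars : real_scalars R R[i].
Proof.
apply: (@RealScalars R R[i] (real_complex R) (@complex.Re R)) => //.
- by case=> a b [c d].
- by move=> r; rewrite -[0 in LHS](rmorph0 (real_complex R)) lecR.
Defined.

End RealRealScalars.

(** * Real-valued norms *)

Section RealNorm.
Variables (R : realType) (K : numFieldType) (rs : real_scalars R K).
Notation inj := (of_real rs).
Notation re := (real_part rs).

Lemma re_inj r : re (inj r) = r.
Proof.
apply: (fmorph_inj inj); case: (leP 0 r) => [r0|r0].
  by rewrite inj_re // inj_ge0.
have rN : re (inj r) = - re (inj (- r)).
  by rewrite -[- r]mulN1r rmorphM reZ mulN1r opprK.
by rewrite rN rmorphN inj_re ?inj_ge0 ?oppr_ge0 ?ltW// rmorphN opprK.
Qed.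

Lemma inj_le r s : (inj r <= inj s) = (r <= s).
Proof. by rewrite -subr_ge0 -rmorphB inj_ge0 subr_ge0. Qed.

Lemma inj_lt r s : (inj r < inj s) = (r < s).
Proof. by rewrite !lt_neqAle inj_le (inj_eq (fmorph_inj inj)). Qed.

Lemma inj_gt0 r : (0 < inj r) = (0 < r).
Proof. by rewrite -[0 in LHS](rmorph0 inj) inj_lt. Qed.

Lemma re_gt0 k : 0 < k -> 0 < re k.
Proof. by move=> k0; rewrite -inj_gt0 inj_re// ltW. Qed.

Section Norm.
Variable V : normedModType K.

(** Norms are brought back from [K] to [R], where the order is total and real suprema and linear
    arithmetic apply; [inj_nrm] shows that nothing is lost. *)
Definition real_norm (x : V) : R := re `|x|.
Notation nrm := real_norm.

Lemma inj_nrm x : inj (nrm x) = `|x|.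
Proof. by rewrite inj_re. Qed.

Lemma nrm_ge0 x : 0 <= nrm x.
Proof. by rewrite -(inj_ge0 rs) inj_nrm. Qed.

Lemma nrm_le x r : (nrm x <= r) = (`|x| <= inj r).
Proof. by rewrite -inj_le inj_nrm. Qed.

Lemma nrm_lt x r : (nrm x < r) = (`|x| < inj r).
Proof. by rewrite -inj_lt inj_nrm. Qed.

Lemma nrm0 : nrm 0 = 0.
Proof. by rewrite /real_norm normr0 -(rmorph0 inj) re_inj. Qed.

Lemma nrm_eq0 x : nrm x = 0 -> x = 0.
Proof. by move=> x0; apply/eqP; rewrite -normr_eq0 -inj_nrm x0 rmorph0. Qed.

Lemma nrmD x y : nrm (x + y) <= nrm x + nrm y.
Proof. by rewrite nrm_le rmorphD !inj_nrm ler_normD. Qed.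

Lemma nrmN x : nrm (- x) = nrm x.
Proof. by rewrite /real_norm normrN. Qed.

Lemma nrmC x y : nrm (x - y) = nrm (y - x).
Proof. by rewrite -nrmN opprB. Qed.

Lemma nrm_dist x y z : nrm (x - z) <= nrm (x - y) + nrm (y - z).
Proof. by apply: le_trans (nrmD _ _); rewrite addrA subrK. Qed.

Lemma nrmZ r x : 0 <= r -> nrm (inj r *: x) = r * nrm x.
Proof.
move=> r0; rewrite /real_norm normrZ ger0_norm ?inj_ge0//.
by rewrite -(inj_nrm x) -rmorphM !re_inj.
Qed.

Lemma nrm_sum n (F : 'I_n -> V) : nrm (\sum_i F i) <= \sum_i nrm (F i).
Proof.
elim/big_ind2: _ => [|x a y b xa yb|//]; first by rewrite nrm0.
by apply: le_trans (nrmD _ _) _; apply: lerD.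
Qed.

Lemma unit_ballE x : unit_ball x <-> nrm x <= 1.
Proof. by rewrite nrm_le rmorph1. Qed.

(** The dual norm and the topology of [G] only see the unit ball; this carries their estimates to
    all vectors by scaling. *)
Lemma le_nrm_homogeneous (f g : V -> R) :
  (forall r x, 0 < r -> f (inj r *: x) = r * f x) ->
  (forall r x, 0 < r -> g (inj r *: x) = r * g x) ->
  f 0 <= g 0 -> (forall x, nrm x = 1 -> f x <= g x) -> forall x, f x <= g x.
Proof.
move=> fZ gZ f0 fg x.
have [->//|x0] := eqVneq x 0.
have nx : 0 < nrm x.
  by rewrite lt_neqAle nrm_ge0 andbT eq_sym; apply: contra_neq x0; apply: nrm_eq0.
have nV : 0 < (nrm x)^-1 by rewrite invr_gt0.
rewrite -(ler_pM2l nV) -fZ// -gZ//; apply: fg.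
by rewrite nrmZ ?(ltW nV)// mulVf// gt_eqF.
Qed.

(** The bound is on the sum of the distances, not on each one, so that a single much smaller term
    can improve the average. *)
Lemma avg_le n (F : 'I_n -> V) c D : (0 < n)%N -> \sum_i nrm (F i - c) <= n%:R * D ->
  nrm (inj n%:R^-1 *: \sum_i F i - c) <= D.
Proof.
move=> n0 FD.
have nR : 0 < (n%:R : R) by rewrite ltr0n.
have -> : inj n%:R^-1 *: \sum_i F i - c = inj n%:R^-1 *: \sum_i (F i - c).
  rewrite sumrB scalerBr sumr_const card_ord -[c *+ n]scaler_nat scalerA.
  by rewrite fmorphV rmorph_nat mulVf ?scale1r// pnatr_eq0 -lt0n.
rewrite nrmZ ?invr_ge0 ?(ltW nR)// ler_pdivrMl//.
exact: le_trans (nrm_sum _) FD.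
Qed.

End Norm.

Notation nrm := real_norm.

Lemma cauchy_nrm_cvg (X : completeNormedModType K) (a : nat -> X) :
  (forall e, 0 < e -> exists N, forall n, (N <= n)%N -> nrm (a N - a n) <= e) ->
  cvg (a @ \oo).
Proof.
move=> ac; apply: cauchy_cvg; apply: cauchy_exP => e e0.
have [|N aN] := ac (re e / 2); first by rewrite divr_gt0 ?re_gt0.
exists (a N); exists N => // n /= Nn; rewrite -ball_normE /=.
rewrite -(inj_re rs (k := e)) ?ltW// -nrm_lt; apply: le_lt_trans (aN n Nn) _.
by have := re_gt0 e0; lra.
Qed.

Lemma cvg_nrm (V : normedModType K) (a : nat -> V) (l : V) e :
  a @ \oo --> l -> 0 < e -> exists N, forall n, (N <= n)%N -> nrm (l - a n) <= e.
Proof.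
move=> /cvgrPdist_lt/(_ (inj e)); rewrite inj_gt0 => /[apply] -[N _ aN].
by exists N => n Nn; rewrite nrm_le ltW//; exact: aN.
Qed.

Lemma cvg_nrm_le (V : normedModType K) (a : nat -> V) (l c : V) D :
  a @ \oo --> l -> (exists N, forall n, (N <= n)%N -> nrm (a n - c) <= D) ->
  nrm (l - c) <= D.
Proof.
move=> al [N aD]; apply/ler_addgt0Pr => e e0.
have [M aM] := cvg_nrm al e0.
have := aM _ (leq_maxr N M); have := aD _ (leq_maxl N M).
have := nrm_dist l (a (maxn N M)) c; lra.
Qed.

End RealNorm.

(** * Averaging over a compact group *)

Section Averaging.
Variables (R : realType) (K : numFieldType) (rs : real_scalars R K).
Variables (X : completeNormedModType K) (G : set (X -> X)).
Hypothesis cG : compact_isometry_group G.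
Notation inj := (of_real rs).
Notation nrm := (real_norm rs).

Let G_lin g : G g -> linear g.
Proof. by move: cG => [+ _ _ _ _] => /[apply] -[]. Qed.

Let G_nrm g x : G g -> nrm (g x) = nrm x.
Proof. by move: cG => [+ _ _ _ _] => /[apply] -[_ gx _]; rewrite /real_norm gx. Qed.

Let G_id : G id. Proof. by case: cG. Qed.

Let G_comp g h : G g -> G h -> G (g \o h).
Proof. by move: cG => [_ _ + _ _]; apply. Qed.

(** Compactness applied to the cover of [G] by operator-norm balls of radius [e]. The net is indexed
    by ['I_n.+1], hence nonempty, so that it can be averaged. *)
Lemma finite_net (e : R) : 0 < e -> exists n (h : 'I_n.+1 -> X -> X),
  (forall i, G (h i)) /\
  forall g, G g -> exists i, forall x, nrm (g x - h i x) <= e * nrm x.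
Proof.
move=> e0; have [_ _ _ _] := cG.
pose B (g : {uniform` @unit_ball K X -> X}) :=
  [set h : {uniform` @unit_ball K X -> X} | forall x, unit_ball x -> `|g x - h x| < inj e].
pose T : ptopologicalType := HB.pack {uniform` @unit_ball K X -> X}
  (isPointed.Build {uniform` @unit_ball K X -> X} id).
rewrite -[compact _]/(@compact T G) compact_cover => /(_ _ G (fun g => (B g)°)).
have BG : G `<=` cover G (fun g => (B g)°).
  move=> g Gg; exists g => //; apply/nbhs_uniform_unit_ball.
  by exists (inj e); rewrite ?inj_gt0.
move=> /(_ (fun g _ => @open_interior _ _) BG) [D DG GD].
pose s : seq (X -> X) := enum_fset D.
have sG g : g \in s -> G g by move=> gs; apply/set_mem/DG.
have sB g : G g -> exists2 h, h \in s & forall x, unit_ball x -> `|h x - g x| < inj e.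
  by move=> /GD[h hD /interior_subset hg]; exists h.
have [h0 h0s _] := sB _ G_id.
have s0 : (0 < size s)%N by case: (s) h0s.
exists (size s).-1, (fun i => nth id s i).
have lts (i : 'I_(size s).-1.+1) : (i < size s)%N by rewrite -[X in (_ < X)%N](prednK s0).
split=> [i|g Gg]; first by apply: sG; rewrite mem_nth.
have [h hs hg] := sB _ Gg.
have hi : (index h s < (size s).-1.+1)%N by rewrite (prednK s0) index_mem.
exists (Ordinal hi); rewrite /= nth_index//.
have lh := G_lin (sG _ hs); have lg := G_lin Gg.
apply: (@le_nrm_homogeneous _ _ rs X (fun x => nrm (g x - h x)) (fun x => e * nrm x)).
- by move=> r x r0; rewrite (linZ lg) (linZ lh) -scalerBr nrmZ ?ltW.
- by move=> r x r0; rewrite nrmZ ?ltW// mulrCA.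
- by rewrite (lin0 lg) (lin0 lh) subr0 nrm0 mulr0.
- move=> x x1; rewrite nrmC x1 mulr1 nrm_le ltW// hg//; apply/(unit_ballE rs).
  by rewrite x1.
Qed.

(* Operators in the convex hull of [G], described by the properties of convex
   combinations that are used instead of by explicit coefficients. *)
Definition hull_op (T : X -> X) :=
  [/\ linear T,
      forall S : X -> X, linear S -> forall D c x,
        (forall g, G g -> nrm (S (g x) - c) <= D) -> nrm (S (T x) - c) <= D &
      forall u : X -> K^o, linear u -> (forall g x, G g -> u (g x) = u x) ->
        forall x, u (T x) = u x].

Lemma hull_id : hull_op id.
Proof. by split=> // S _ D c x /(_ _ G_id). Qed.

(** This is why [hull_op] quantifies over all linear [S]: the property of [T2] is used for
    [S \o T1], then that of [T1] for [S] at the points [g x]. *)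
Lemma hull_comp T1 T2 : hull_op T1 -> hull_op T2 -> hull_op (T1 \o T2).
Proof.
move=> [l1 h1 u1] [l2 h2 u2]; split.
- exact: comp_linear.
- move=> S lS D c x SD; apply: (h2 (S \o T1) (comp_linear lS l1)) => g Gg.
  by apply: (h1 S lS) => k Gk; exact: SD (G_comp Gk Gg).
- by move=> u lu uG x /=; rewrite u1// u2.
Qed.

Lemma hull_nrm T x : hull_op T -> nrm (T x) <= nrm x.
Proof.
move=> [_ hT _]; have := hT id (fun _ _ _ => erefl) (nrm x) 0 x.
by rewrite subr0; apply=> g Gg; rewrite subr0 G_nrm.
Qed.

Definition osc_le (T : X -> X) (D : R) := forall g k, G g -> G k ->
  forall x, nrm (T (g x) - T (k x)) <= D * nrm x.

(** [T (A x)] behaves like a convex combination of the [T (g x)], each within [D * nrm x] of [T x].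
    This will give the Cauchy estimate for products of averages. *)
Lemma hull_osc T A D x : linear T -> hull_op A -> osc_le T D ->
  nrm (T (A x) - T x) <= D * nrm x.
Proof. by move=> lT [_ hA _] TD; apply: hA => // g Gg; exact: TD G_id x. Qed.

Section Average.
Variables (n : nat) (h : 'I_n.+1 -> X -> X).
Hypothesis Gh : forall i, G (h i).

Definition average (x : X) := inj n.+1%:R^-1 *: \sum_i h i x.

Lemma average_linear : linear average.
Proof.
move=> k x y; rewrite /average.
have -> : \sum_i h i (k *: x + y) = k *: \sum_i h i x + \sum_i h i y.
  by rewrite scaler_sumr -big_split; apply: eq_bigr => i _; rewrite (G_lin (Gh i)).
by rewrite scalerDr !scalerA mulrC.
Qed.

Lemma lin_average (V : lmodType K) (S : X -> V) x : linear S ->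
  S (average x) = inj n.+1%:R^-1 *: \sum_i S (h i x).
Proof. by move=> lS; rewrite (linZ lS) (lin_sum lS). Qed.

Lemma hull_average : hull_op average.
Proof.
split; first exact: average_linear.
- move=> S lS D c x SD; rewrite lin_average//; apply: avg_le => //.
  apply: (@le_trans _ _ (\sum_(i < n.+1) D)); first by apply: ler_sum => i _; apply: SD.
  by rewrite sumr_const card_ord mulr_natl.
- move=> u lu uG x; rewrite lin_average//.
  rewrite (eq_bigr (fun=> u x)) => [|i _]; last exact: uG.
  rewrite sumr_const card_ord -[u x *+ _]scaler_nat scalerA.
  by rewrite fmorphV rmorph_nat mulVf ?scale1r// pnatr_eq0.
Qed.

(* Among the maps [T (h i) g] one is close to [T k], the others being within [D]:
   averaging over [i] contracts the oscillation. *)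
Lemma osc_average e T D : 
  (forall g, G g -> exists i, forall x, nrm (g x - h i x) <= e * nrm x) ->
  hull_op T -> osc_le T D -> osc_le (T \o average) ((n%:R * D + e) / n.+1%:R).
Proof.
move=> net hT TD; have [lT _ _] := hT.
have half g k x : G g -> G k ->
    nrm (T (average (g x)) - T (k x)) <= (n%:R * D + e) / n.+1%:R * nrm x.
  move=> Gg Gk; rewrite lin_average//; apply: avg_le => //.
  have [g' Gg' [gK g'K]] : exists2 g', G g' & cancel g g' /\ cancel g' g.
    by move: cG => [_ _ _ + _]; apply.
  (* The net is used at [k g^-1] and the estimate is then evaluated at [g x], so that [h i0 (g x)]
     is close to [k x]. *)
  have [i0 hi0] := net _ (G_comp Gk Gg').
  rewrite (bigD1 i0)//= mulrA mulrCA divff ?pnatr_eq0// mulr1 addrC mulrDl.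
  apply: lerD.
    apply: (@le_trans _ _ (\sum_(i < n.+1 | i != i0) (D * nrm x))).
      by apply: ler_sum => i _; exact: TD (G_comp (Gh i) Gg) Gk x.
    by rewrite sumr_const cardC1 card_ord -[X in X <= _]mulr_natl mulrA.
  rewrite -(linB lT); apply: le_trans (hull_nrm _ hT) _; rewrite nrmC.
  by have := hi0 (g x); rewrite /= gK (G_nrm _ Gg).
(* The second average is expanded in turn: [half] applies to each of its terms, with [h i \o k] in
   place of [k]. *)
move=> g k Gg Gk x /=; rewrite nrmC lin_average//; apply: avg_le => //.
apply: le_trans (_ : \sum_(i < n.+1) (n%:R * D + e) / n.+1%:R * nrm x <= _).
  apply: ler_sum => i _; rewrite nrmC; exact: half Gg (G_comp (Gh i) Gk).
by rewrite sumr_const card_ord -[X in X <= _]mulr_natl.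
Qed.

End Average.

(** The average over one fixed net of mesh [e / 2] is iterated. The bound of [osc_average] is affine
    in [D] with fixed point [e / 2] and slope [q < 1], and the oscillation of the identity is at
    most [2]. *)
Lemma exists_hull_osc e : 0 < e -> exists A, hull_op A /\ osc_le A e.
Proof.
move=> e0; have e20 : 0 < e / 2 by lra.
have [n [h [Gh net]]] := finite_net e20.
pose q : R := n%:R / n.+1%:R.
have nS : (n.+1%:R : R) = n%:R + 1 by rewrite -natr1.
have n0 : 0 <= (n%:R : R) by rewrite ler0n.
have it m : hull_op (iter m (fun T => T \o average h) id) /\
    osc_le (iter m (fun T => T \o average h) id) (e / 2 + 2 * q ^+ m).
  elim: m => [|m [hT TD]] /=.
    split; first exact: hull_id.
    move=> g k Gg Gk x; rewrite expr0; apply: le_trans (nrmD _ _ _) _.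
    rewrite nrmN !G_nrm//; have := nrm_ge0 rs x; nra.
  split; first exact: hull_comp hT (hull_average Gh).
  have := osc_average Gh net hT TD; congr osc_le.
  rewrite exprS; move: (q ^+ m) => y; rewrite /q nS; field; lra.
have q1 : `|q| < 1.
  by rewrite ger0_norm ?divr_ge0 ?ler0n// ltr_pdivrMr ?ltr0n// mul1r ltr_nat.
have e40 : 0 < e / 4 by lra.
have /cvgrPdist_lt/(_ _ e40)[m _ /(_ m (leqnn m))] := cvg_expr q1.
rewrite sub0r normrN => qm.
exists (iter m (fun T => T \o average h) id); have [hT TD] := it m; split=> //.
move=> g k Gg Gk x; apply: le_trans (TD g k Gg Gk x) _.
rewrite ler_wpM2r ?nrm_ge0//; have := ler_norm (q ^+ m); lra.
Qed.

(** [Q] is the pointwise limit of products of hull operators whose oscillation tends to [0].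
    Invariance under [G] comes from that oscillation, and [u Q = u] from the continuity of [u]. *)
Lemma averaging_projection : exists Q : X -> X,
  [/\ linear Q, forall x, nrm (Q x) <= nrm x,
      forall g x, G g -> Q (g x) = Q x,
      forall u x, invariant_dual G u -> u (Q x) = u x &
      forall x, Q (Q x) = Q x].
Proof.
have [A hA] := choice (fun m => exists_hull_osc (harmonic_gt0 (R := R) m)).
(* New factors go on the right: each later product is then [T m.+1 \o B] with [B] in the hull, and
   [hull_osc] bounds its distance to [T m.+1]. *)
pose fix T m : X -> X := if m is m'.+1 then T m' \o A m' else id.
have hT m : hull_op (T m).
  by elim: m => [|m IH]; [exact: hull_id|exact: hull_comp IH (hA m).1].
have lT m : linear (T m) by case: (hT m).
have TD m : osc_le (T m.+1) (harmonic m).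
  move=> g k Gg Gk x /=; rewrite -(linB (lT m)).
  by apply: le_trans (hull_nrm _ (hT m)) _; exact: (hA m).2.
have TB N n : (N <= n)%N -> exists2 B, hull_op B & T n = T N \o B.
  elim: n => [|n IH]; first by rewrite leqn0 => /eqP ->; exists id => //; exact: hull_id.
  rewrite leq_eqVlt => /predU1P[<-|/IH[B hB TB]]; first by exists id => //; exact: hull_id.
  exists (B \o A n); first exact: hull_comp hB (hA n).1.
  by rewrite /= TB.
have Tdist m n x : (m < n)%N -> nrm (T n x - T m.+1 x) <= harmonic m * nrm x.
  move=> /TB[B hB ->] /=; exact: hull_osc (lT m.+1) hB (TD m).
have harm (e : R) y : 0 < e -> 0 <= y -> exists m, harmonic m * y <= e.
  move=> e0 y0; have ey : 0 < e / (y + 1) by rewrite divr_gt0//; lra.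
  have /cvgrPdist_lt/(_ _ ey)[m _ /(_ m (leqnn m))] := cvg_harmonic (R := R).
  rewrite sub0r normrN ger0_norm ?harmonic_ge0// ltr_pdivlMr; last lra.
  have := harmonic_ge0 (R := R) m => h0; exists m; nra.
have Tcvg x : cvg (T^~ x @ \oo).
  apply: (cauchy_nrm_cvg (rs := rs)) => e e0.
  have [m me] := harm e _ e0 (nrm_ge0 rs x); exists m.+1 => n mn.
  by rewrite nrmC; apply: le_trans (Tdist _ _ _ mn) me.
have [Q TQ] := choice (fun x => (cvg_ex _).1 (Tcvg x)).
have lQ : linear Q.
  move=> k x y; apply: (cvg_unique _ (TQ (k *: x + y))) => //.
  rewrite (_ : T^~ _ = fun n => k *: T n x + T n y); last first.
    by apply/funext => n; rewrite lT.
  by apply: cvgD => //; apply: cvgZr.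
have nQ x : nrm (Q x) <= nrm x.
  rewrite -[Q x]subr0; apply: cvg_nrm_le (TQ x) _; exists 0%N => n _.
  by rewrite subr0; exact: hull_nrm (hT n).
have uQ u x : invariant_dual G u -> u (Q x) = u x.
  move=> [[lu cu] uG].
  have := cvg_comp (T^~ x) u (TQ x) (cu (Q x)).
  have uT n : u (T n x) = u x.
    by case: (hT n) => _ _; apply=> // g y Gg; exact: uG.
  rewrite (_ : u \o _ = cst (u x)); last by apply/funext => n /=; rewrite uT.
  by move=> /cvg_lim <-//; exact: lim_cst.
have Qdist m x : nrm (Q x - T m.+1 x) <= harmonic m * nrm x.
  by apply: cvg_nrm_le (TQ x) _; exists m.+1 => n; exact: Tdist.
have Qg g x : G g -> Q (g x) = Q x.
  move=> Gg; apply/eqP; rewrite -subr_eq0; apply/eqP/(nrm_eq0 (rs := rs)).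
  apply/eqP; rewrite eq_le nrm_ge0 andbT; apply/ler_addgt0Pr => e e0; rewrite add0r.
  have [||m me] := harm (e / 3) (nrm x); rewrite ?nrm_ge0//; first lra.
  have := nrm_dist rs (Q (g x)) (T m.+1 (g x)) (Q x).
  have := nrm_dist rs (T m.+1 (g x)) (T m.+1 x) (Q x).
  have := Qdist m (g x); rewrite (G_nrm x Gg).
  have := Qdist m x; rewrite (nrmC rs (Q x) (T m.+1 x)).
  have : nrm (T m.+1 (g x) - T m.+1 x) <= harmonic m * nrm x := TD m g id Gg G_id x.
  lra.
exists Q; split=> // x.
apply/eqP; rewrite -subr_eq0; apply/eqP/(nrm_eq0 (rs := rs)).
(* [Q] is constant on orbits, so the hull property with [S = Q], [c = Q x] and [D = 0] applies;
   letting [m] grow gives [Q (Q x) = Q x]. *)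
have QT m : Q (T m x) = Q x.
  apply/eqP; rewrite -subr_eq0; apply/eqP/(nrm_eq0 (rs := rs)).
  apply/eqP; rewrite eq_le nrm_ge0 andbT.
  have [_ hTm _] := hT m; apply: hTm => // g Gg; rewrite Qg// subrr nrm0//.
apply/eqP; rewrite eq_le nrm_ge0 andbT; apply/ler_addgt0Pr => e e0; rewrite add0r.
have [N /(_ N (leqnn N))] := cvg_nrm rs (TQ x) e0.
by rewrite -(QT N) -(linB lQ) QT => h; apply: le_trans (nQ _) h.
Qed.

End Averaging.

(** * Dual norms *)

Section DualNorm.
Variables (R : realType) (K : numFieldType) (rs : real_scalars R K).
Variable (X : normedModType K).
Notation inj := (of_real rs).
Notation re := (real_part rs).
Notation nrm := (real_norm rs).

Lemma inj_norm r : `|inj r| = inj `|r|.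
Proof.
have [r0|r0] := leP 0 r; first by rewrite !ger0_norm ?inj_ge0.
by rewrite (ltr0_norm r0) -normrN -rmorphN ger0_norm// inj_ge0 oppr_ge0 ltW.
Qed.

Lemma exists_phase (k : K) : exists2 c : K, `|c| = 1 & c * k = `|k|.
Proof.
have [->|k0] := eqVneq k 0; first by exists 1; rewrite ?normr1// mulr0 normr0.
exists (`|k| / k); last by rewrite divfK.
by rewrite normrM normfV normr_id divff// normr_eq0.
Qed.

Lemma dual_spaceP (f : X -> K^o) : dual_space f <->
  linear f /\ exists C, forall x, nrm (f x) <= C * nrm x.
Proof.
split=> [[lf cf]|[lf [C fC]]]; split=> //.
  pose fl : {linear X -> K^o} := HB.pack f (GRing.isLinear.Build K X K^o *:%R f lf).
  have /linear_boundedP[M [Mr fM]] : bounded_near fl (nbhs 0).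
    exact: (linear_bounded_continuous fl).2.
  have M1 : M < `|M| + 1 by apply: le_lt_trans (real_ler_norm Mr) _; rewrite ltrDl.
  have C0 : 0 <= `|M| + 1 by rewrite addr_ge0.
  exists (re (`|M| + 1)) => x; have := fM _ M1 x.
  by rewrite nrm_le rmorphM inj_re// inj_nrm.
pose fl : {linear X -> K^o} := HB.pack f (GRing.isLinear.Build K X K^o *:%R f lf).
apply: (linear_bounded_continuous fl).1; apply/linear_boundedP.
exists (inj C); split=> [|r rC x].
  by rewrite realE -{1 2}(rmorph0 inj) !inj_le le_total.
apply: (@le_trans _ _ (inj C * `|x|)); last by rewrite ler_wpM2r// ltW.
by rewrite -(inj_nrm rs x) -rmorphM -nrm_le.
Qed.

Lemma dual_spaceDZ (f g : X -> K^o) k : dual_space f -> dual_space g ->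
  dual_space (f + k *: g).
Proof.
move=> /dual_spaceP[lf [C fC]] /dual_spaceP[lg [D gD]]; apply/dual_spaceP; split.
  move=> l x y; rewrite !fctE lf lg !scalerDr !scalerA [k * l]mulrC.
  by rewrite -!addrA; congr (_ + _); rewrite addrCA.
exists (C + nrm (k : K^o) * D) => x; rewrite fctE; apply: le_trans (nrmD _ _ _) _.
rewrite mulrDl lerD// -mulrA.
have -> : nrm (k *: g x) = nrm (k : K^o) * nrm (g x).
  by apply: (fmorph_inj inj); rewrite rmorphM !inj_nrm normrZ.
by rewrite ler_wpM2l ?nrm_ge0.
Qed.

Definition real_dual_norm (f : X -> K^o) : R := re (dual_norm f).
Notation dnrm := real_dual_norm.

(** [supremum] returns its default [0] unless a least upper bound exists for the order of [K]. The
    image of the real supremum is one: every upper bound in [K] is nonnegative, hence the image of a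
    real. *)
Lemma dual_norm_lub (f : X -> K^o) : dual_space f ->
  supremums [set `|f x| | x in @unit_ball K X] (dual_norm f).
Proof.
move=> /dual_spaceP[lf [C fC]]; rewrite /dual_norm /supremum.
set A := [set `|f x| | x in _].
have A0 : A `|f 0| by exists 0 => //; rewrite /unit_ball /= normr0 ler01.
case: eqP => [E|_]; first by rewrite E in A0.
have hs : has_sup [set nrm (f x) | x in @unit_ball K X].
  split; first by exists (nrm (f 0)); exists 0; rewrite /unit_ball //= normr0 ler01.
  exists `|C| => _ [x /(unit_ballE rs) x1 <-]; apply: le_trans (fC x) _.
  have := ler_norm C; have := nrm_ge0 rs x; have := normr_ge0 C; nra.
case: xgetP => [s ->//|H]; exfalso.
apply: (H (inj (sup [set nrm (f x) | x in @unit_ball K X]))); split.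
- move=> _ [x x1 <-]; rewrite -(inj_nrm rs) inj_le.
  by apply: ub_le_sup; [case: hs|exists x].
- move=> b bA; have b0 : 0 <= b by apply: le_trans (bA _ A0).
  rewrite -(inj_re rs b0) inj_le; apply: ge_sup; first by case: hs.
  by move=> _ [x x1 <-]; rewrite nrm_le inj_re//; apply: bA; exists x.
Qed.

Lemma dual_norm_ge0 (f : X -> K^o) : dual_space f -> 0 <= dual_norm f.
Proof.
move=> /dual_norm_lub[ub _]; apply: le_trans (ub `|f 0| _) => //.
by exists 0; rewrite /unit_ball //= normr0 ler01.
Qed.

Lemma inj_dnrm (f : X -> K^o) : dual_space f -> inj (dnrm f) = dual_norm f.
Proof. by move=> /dual_norm_ge0 f0; rewrite inj_re. Qed.

Lemma dnrm_ge0 (f : X -> K^o) : dual_space f -> 0 <= dnrm f.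
Proof. by move=> df; rewrite -(inj_ge0 rs) inj_dnrm// dual_norm_ge0. Qed.

Lemma nrm_le_dnrm (f : X -> K^o) x : dual_space f -> nrm (f x) <= dnrm f * nrm x.
Proof.
move=> df; have lf := df.1; have [ub _] := dual_norm_lub df.
apply: (@le_nrm_homogeneous _ _ rs X (fun x => nrm (f x)) (fun x => dnrm f * nrm x)).
- by move=> r y r0; rewrite (linZ lf) nrmZ ?ltW.
- by move=> r y r0; rewrite nrmZ ?ltW// mulrCA.
- by rewrite (lin0 lf) !nrm0 mulr0.
- move=> y y1; rewrite y1 mulr1 nrm_le inj_dnrm//; apply: ub.
  by exists y => //; apply/(unit_ballE rs); rewrite y1.
Qed.

Lemma re_le_nrm (k : K^o) : re k <= nrm k.
Proof. exact: re_le_norm. Qed.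

(** Real parts suffice because multiplying [x] by a scalar of modulus one turns [f x] into its
    modulus without changing the norm of [x]. *)
Lemma dnrm_le (f : X -> K^o) M : dual_space f -> (forall x, nrm x <= 1 -> re (f x) <= M) ->
  dnrm f <= M.
Proof.
move=> df fM; rewrite -(inj_le rs) inj_dnrm//; apply: (dual_norm_lub df).2.
move=> _ [x /(unit_ballE rs) x1 <-].
have [c c1 cf] := exists_phase (f x).
rewrite -(inj_nrm rs) inj_le.
have -> : nrm (f x) = re (f (c *: x)) by rewrite (linZ df.1) /= -[c *: _]/(c * _) cf.
apply: fM; have -> // : nrm (c *: x) = nrm x.
by rewrite /real_norm normrZ c1 mul1r.
Qed.

(** The limit [l] is eliminated by comparing two quotients that are both within [e / 2] of it, with
    [t0] independent of [z]. *)
Lemma dual_G_SSD_uniform (G : set (X -> X)) u :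
  dual_G_SSD G -> invariant_dual G u -> dual_norm u = 1 ->
  forall e, 0 < e -> exists2 t0, 0 < t0 & forall t, 0 < t -> t <= t0 ->
  forall z, invariant_dual_ball G z ->
  (dnrm (u + inj t0 *: z) - 1) / t0 <= (dnrm (u + inj t *: z) - 1) / t + e.
Proof.
move=> ssd Gu u1 e e0; have [l ul] := ssd u Gu u1.
have ie : 0 < inj (e / 2) by rewrite inj_gt0; lra.
pose P (F : (X -> K^o) -> K^o) := forall z, invariant_dual_ball G z ->
  `|l z - F z| < inj (e / 2).
have lP : nbhs (l : {uniform` invariant_dual_ball G -> K^o}) P.
  apply/uniform_nbhs; exists [set xy | ball xy.1 (inj (e / 2)) xy.2]; split.
    by rewrite -entourage_ballE; exists (inj (e / 2)).
  by move=> F /= lF z Gz; have := lF z Gz; rewrite -ball_normE.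
have /nbhs_ballP[d d0 dP] := ul _ lP.
(* Half the radius keeps [t0] itself strictly inside the ball of radius [d]. *)
have d1 : 0 < re d / 2 by rewrite divr_gt0// re_gt0.
have close t z : 0 < t -> t <= re d / 2 -> invariant_dual_ball G z ->
    `|l z - inj ((dnrm (u + inj t *: z) - 1) / t)| < inj (e / 2).
  move=> t0 td Gz; have -> : inj ((dnrm (u + inj t *: z) - 1) / t) =
      (dual_norm (u + inj t *: z) - 1) / inj t.
    by rewrite rmorphM fmorphV rmorphB rmorph1 inj_dnrm//; apply: dual_spaceDZ Gu.1 Gz.1.1.
  have := dP (inj t); rewrite -ball_normE /= sub0r normrN gtr0_norm ?inj_gt0//.
  apply=> //; rewrite -(inj_re rs (ltW d0)) inj_lt; lra.
exists (re d / 2) => // t t0 td z Gz.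
set a := (_ / (re d / 2)); set b := (_ / t).
rewrite -lerBlDl; apply: le_trans (ler_norm _) _; rewrite -(inj_le rs) -inj_norm.
rewrite rmorphB; apply: le_trans (ler_distD (l z) _ _) _.
have -> : e = e / 2 + e / 2 by lra.
rewrite rmorphD lerD// ltW//; last exact: close.
by rewrite distrC close.
Qed.

End DualNorm.

(** * Norm attainment *)

Section NormAttaining.
Variables (R : realType) (K : numFieldType) (rs : real_scalars R K).
Variables (X : completeNormedModType K) (G : set (X -> X)).
Notation inj := (of_real rs).
Notation re := (real_part rs).
Notation nrm := (real_norm rs).
Notation dnrm := (real_dual_norm rs).

Section UnitFunctional.
Variables (Q : X -> X) (u : X -> K^o).
Hypotheses (lQ : linear Q) (nQ : forall x, nrm (Q x) <= nrm x).
Hypothesis QG : forall g x, G g -> Q (g x) = Q x.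
Hypothesis uQ : forall v x, invariant_dual G v -> v (Q x) = v x.
Hypotheses (Gu : invariant_dual G u) (u1 : dual_norm u = 1).

Let N x := nrm (Q x).
Let U x := re (u x).

Let lu : linear u. Proof. exact: Gu.1.1. Qed.

Let ND x y : N (x + y) <= N x + N y.
Proof. by rewrite /N (linD lQ) nrmD. Qed.

Let NN x : N (- x) = N x.
Proof. by rewrite /N (linN lQ) nrmN. Qed.

Let NZ r x : 0 <= r -> N (inj r *: x) = r * N x.
Proof. by move=> r0; rewrite /N (linZ lQ) nrmZ. Qed.

Let UD x y : U (x + y) = U x + U y.
Proof. by rewrite /U (linD lu) reD. Qed.

Let UZ r x : U (inj r *: x) = r * U x.
Proof. by rewrite /U (linZ lu) reZ. Qed.

Let dnrm1 : dnrm u = 1.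
Proof. by rewrite /real_dual_norm u1 -(rmorph1 inj) re_inj. Qed.

Let UN x : U x <= N x.
Proof.
rewrite /U -(uQ _ Gu); apply: le_trans (re_le_nrm _ _) _.
by apply: le_trans (nrm_le_dnrm _ _ Gu.1) _; rewrite dnrm1 mul1r.
Qed.

(** Separation for the seminorm [N]. Domination by [N] gives both the norm bound on [z], since [Q]
    is a contraction, and its invariance, since [N (g v - v) = 0]. *)
Lemma invariant_separation x e a : 0 < e ->
  (forall c, N c <= 1 -> a <= U c -> e <= N (c - x)) ->
  exists2 z, invariant_dual_ball G z &
    (forall y, re (z y) <= N y) /\
    (forall c, N c <= 1 -> a <= U c -> re (z c) <= re (z x) - e).
Proof.
move=> e0 far; pose W := restrict_scalars inj X.
(* The values whose infimum is the sublinear functional [p]; [c.2] ranges over the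
   multiples by [c.1] of the points of the slice, so that [p (c - x) <= - e] for
   [c] in the slice. *)
pose S (v : X) := [set N (v - c.2 + inj c.1 *: x) - c.1 * e | c in
  [set c : R * X | [/\ 0 <= c.1, N c.2 <= c.1 & a * c.1 <= U c.2]]].
have S_lb v : lbound (S v) (- N v).
  move=> _ [[s c] /= [s0 cs ac] <-].
  (* For [s > 0] this is the hypothesis [far] at the slice point [s^-1 c], multiplied by [s]. *)
  have : s * e <= N (c - inj s *: x).
    have [->|sn0] := eqVneq s 0; first by rewrite mul0r nrm_ge0.
    have sp : 0 < s by rewrite lt_neqAle eq_sym sn0.
    have sV : 0 <= s^-1 by rewrite invr_ge0.
    have cE : c = inj s *: (inj s^-1 *: c).
      by rewrite scalerA -rmorphM divff// rmorph1 scale1r.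
    rewrite cE -scalerBr NZ// ler_pM2l//; apply: far.
      by rewrite NZ// ler_pdivrMl// mulr1.
    by rewrite UZ ler_pdivlMl// mulrC.
  have := ND (- (v - c + inj s *: x)) v.
  rewrite (_ : _ + v = c - inj s *: x); last first.
    by rewrite opprD opprB addrAC subrK.
  by rewrite NN; lra.
have S_inf v : has_inf (S v).
  split; last by exists (- N v); exact: S_lb.
  exists (N (v - 0 + inj 0 *: x) - 0 * e), (0, 0) => //=.
  by rewrite mulr0 /N (lin0 lQ) nrm0 /U (lin0 lu) -(rmorph0 inj) re_inj.
have Sp v b : S v b -> inf (S v) <= b by apply: ge_inf; case: (S_inf v).
have S_add (v w : X) b b' : S v b -> S w b' -> exists2 c, S (v + w) c & c <= b + b'.
  move=> [[s c] /= [s0 cs ac] <-] [[t d] /= [t0 dt ad] <-].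
  exists (N ((v + w) - (c + d) + inj (s + t) *: x) - (s + t) * e).
    exists (s + t, c + d) => //=; split; first exact: addr_ge0.
      by apply: le_trans (ND _ _) _; exact: lerD.
    by rewrite UD mulrDr lerD.
  have := ND (v - c + inj s *: x) (w - d + inj t *: x).
  have -> : v - c + inj s *: x + (w - d + inj t *: x) =
      v + w - (c + d) + inj (s + t) *: x.
    by rewrite addrACA rmorphD scalerDl opprD (addrACA v).
  lra.
have S_scale r (v : X) b : 0 < r -> S v b -> S (inj r *: v) (r * b).
  move=> r0 [[s c] /= [s0 cs ac] <-]; exists (r * s, inj r *: c) => /=.
    split; first by rewrite mulr_ge0// ltW.
      by rewrite NZ ?(ltW r0)// ler_pM2l.
    by rewrite UZ mulrCA ler_pM2l.
  rewrite mulrBr -NZ ?(ltW r0)// scalerDr scalerBr scalerA -rmorphM.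
  by rewrite mulrA.
have sS : sublinear (fun v : W => inf (S v)) by exact: sublinear_inf.
have [z [zD zZ zp]] := Hahn_Banach_sublinear sS.
have [zK lz zE] := @re_lift _ _ rs X z zD zZ.
have zN v : z v <= N v.
  apply: le_trans (zp v) _; apply: Sp; exists (0, 0) => /=; last first.
    by rewrite rmorph0 scale0r addr0 subr0 mul0r subr0.
  by rewrite mulr0 /N (lin0 lQ) nrm0 /U (lin0 lu) -(rmorph0 inj) re_inj.
(* The bound passes from the real part to the modulus because [N] is unchanged by scalars of modulus
   one. *)
have zKN v : nrm (zK v) <= N v.
  have [c c1 cz] := exists_phase (zK v).
  have -> : nrm (zK v) = z (c *: v).
    by rewrite -zE (linZ lz) /= -[c *: _]/(c * _) cz.
  apply: le_trans (zN _) _.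
  by rewrite /N (linZ lQ) /real_norm normrZ c1 mul1r.
have dz : dual_space zK.
  apply/(dual_spaceP rs); split=> //; exists 1 => v; rewrite mul1r.
  exact: le_trans (zKN v) (nQ v).
exists zK.
  split; first split=> // g v Gg.
    apply/eqP; rewrite -subr_eq0 -(linB lz); apply/eqP/(nrm_eq0 (rs := rs)).
    apply/eqP; rewrite eq_le nrm_ge0 andbT; apply: le_trans (zKN _) _.
    by rewrite /N (linB lQ) QG// subrr nrm0.
  rewrite -(inj_dnrm rs dz) -(rmorph1 inj) inj_le; apply: dnrm_le => // v v1.
  by rewrite zE; apply: le_trans (zN v) _; apply: le_trans (nQ v) v1.
split=> [y|c c1 ac]; first by rewrite zE.
rewrite !zE; have : z (c - x) <= - e.
  apply: le_trans (zp _) _; apply: Sp; exists (1, c) => /=.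
    by split=> //; rewrite mulr1.
  by rewrite rmorph1 scale1r addrAC subrK subrr /N (lin0 lQ) nrm0 sub0r mul1r.
have -> : z (c - x) = z c - z x.
  have := zD (c - x : W) x; rewrite (_ : (c - x : X) + x = c) ?subrK//.
  lra.
lra.
Qed.

(** The order of the quantifiers is the point: [d] is chosen before [x] and [d'], on which the
    separating [z] depends. This is where uniformity over the invariant ball enters. *)
Lemma SSD_step e : dual_G_SSD G -> 0 < e -> exists2 d, 0 < d &
  forall x, N x <= 1 -> 1 - d < U x -> forall d', 0 < d' ->
  exists c, [/\ N c <= 1, 1 - d' <= U c & N (c - x) <= e].
Proof.
move=> ssd e0; have e40 : 0 < e / 4 by lra.
have [t0 t00 ut] := dual_G_SSD_uniform rs ssd Gu u1 e40.
exists (t0 * (e / 4)) => [|x x1 Ux d' d'0]; first exact: mulr_gt0.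
apply: contrapT => noc.
have [|z Gz [zN zsep]] := @invariant_separation x e (1 - d') e0.
  move=> c c1 Uc; rewrite leNgt; apply/negP => cx; apply: noc; exists c.
  by split=> //; exact: ltW.
have lz := Gz.1.1.1.
have zx1 : - 1 <= re (z x).
  have := zN (- x); rewrite NN (linN lz) -[- z x]mulN1r -(rmorphN1 inj) reZ; lra.
(* Off the slice, [U y < 1 - d'] and [re (z y) <= 1]; since [re (z x) >= - 1], the condition
   [t * (2 + e) <= d'] yields [U y + t * re (z y) <= 1 + t * (re (z x) - e)] there too. *)
pose t := Num.min t0 (d' / (2 + e)).
have de : 0 < d' / (2 + e) by rewrite divr_gt0//; lra.
have tp : 0 < t by rewrite lt_min t00.
have e2 : 0 < 2 + e by lra.
have td : t * (2 + e) <= d' by rewrite -(ler_pdivlMr _ _ e2) ge_min lexx orbT.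
have dt s : dual_space (u + inj s *: z).
  by apply: (dual_spaceDZ rs); [exact: Gu.1|exact: Gz.1.1].
have ret s y : re ((u + inj s *: z) y) = U y + s * re (z y).
  by rewrite -[(_ + _) y]/(u y + inj s * z y) reD reZ.
have up : dnrm (u + inj t *: z) - 1 <= t * (re (z x) - e).
  rewrite lerBlDl; apply: dnrm_le => // y y1; rewrite ret.
  have y1N := le_trans (nQ y) y1 : N y <= 1.
  have := zN y; have := UN y; have [yd|yd] := leP (1 - d') (U y).
    by have := zsep y y1N yd; nra.
  nra.
(* [x] itself may lie outside the unit ball, but [Q x] lies in it and gives the same values of [u]
   and [z]. *)
have lo : U x + t0 * re (z x) <= dnrm (u + inj t0 *: z).
  have := ret t0 (Q x); rewrite /U (uQ x Gu) (uQ x Gz.1) => <-.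
  apply: le_trans (re_le_nrm _ _) _.
  apply: le_trans (nrm_le_dnrm _ _ (dt t0)) _.
  by rewrite -[leRHS]mulr1 ler_wpM2l// dnrm_ge0.
have := ut t tp _ z Gz; rewrite ge_min lexx => /(_ isT).
have F1 : (dnrm (u + inj t *: z) - 1) / t <= re (z x) - e.
  by rewrite ler_pdivrMr// mulrC.
have F0 : re (z x) - e / 4 < (dnrm (u + inj t0 *: z) - 1) / t0.
  by rewrite ltr_pdivlMr//; lra.
(* The quotient at [t0] exceeds [re (z x) - e / 4], yet it is at most the quotient at [t] plus
   [e / 4], hence at most [re (z x) - 3 e / 4]. *)
lra.
Qed.

End UnitFunctional.

(** Successive moves of size at most [2^-1 ^+ n] are summable. They are measured through [Q], so it
    is the sequence [Q (a n)] that converges; [u] has the same values along it as along [a]. *)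
Lemma unit_invariant_attains (u : X -> K^o) : compact_isometry_group G ->
  dual_G_SSD G -> invariant_dual G u -> dual_norm u = 1 ->
  exists2 y, `|y| = 1 & u y = 1.
Proof.
move=> cG ssd Gu u1.
have [Q [lQ nQ QG uQ QQ]] := averaging_projection rs cG.
have du : dnrm u = 1 by rewrite /real_dual_norm u1 -(rmorph1 inj) re_inj.
have step := SSD_step lQ nQ QG uQ Gu u1 ssd.
have half_gt0 n : 0 < 2^-1 ^+ n :> R by rewrite exprn_gt0.
have dex n : exists d, [/\ 0 < d, d <= 2^-1 ^+ n &
    forall x, nrm (Q x) <= 1 -> 1 - d < re (u x) -> forall d', 0 < d' ->
    exists c, [/\ nrm (Q c) <= 1, 1 - d' <= re (u c) & nrm (Q (c - x)) <= 2^-1 ^+ n]].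
  have [d d0 dP] := step _ (half_gt0 n); exists (Num.min d (2^-1 ^+ n)).
  split; rewrite ?lt_min ?ge_min ?d0 ?lexx ?orbT ?half_gt0// => x x1 Ux.
  by apply: dP => //; apply: le_lt_trans Ux; rewrite lerB// ge_min lexx.
have [d dP] := choice dex.
pose good n x := nrm (Q x) <= 1 /\ 1 - d n < re (u x).
have next (nx : nat * X) : exists c, good nx.1 nx.2 ->
    good nx.1.+1 c /\ nrm (Q (c - nx.2)) <= 2^-1 ^+ nx.1.
  case: nx => n x /=; have [[x1 Ux]|bad] := pselect (good n x); last by exists x.
  have [_ _ /(_ x x1 Ux)] := dP n; have [dn0 _ _] := dP n.+1.
  (* Halving turns the weak inequality provided by the step into the strict one required by
     [good n.+1]. *)
  have d20 : 0 < d n.+1 / 2 by lra.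
  move=> /(_ _ d20)[c [c1 Uc cx]]; exists c => _; split=> //; split=> //; lra.
have [F FP] := choice next.
have [x0 gx0] : exists x, good 0%N x.
  apply: contrapT => nogood; have [d00 _ _] := dP 0%N.
  suff : dnrm u <= 1 - d 0%N by rewrite du; lra.
  apply: dnrm_le; first exact: Gu.1.
  move=> x x1; rewrite leNgt; apply/negP => Ux; apply: nogood; exists x; split=> //.
  exact: le_trans (nQ x) x1.
pose fix a n : X := if n is m.+1 then F (m, a m) else x0.
have ga n : good n (a n) by elim: n => [//|n IH]; exact: (FP (n, a n) IH).1.
have da n : nrm (Q (a n.+1 - a n)) <= 2^-1 ^+ n by exact: (FP (n, a n) (ga n)).2.
(* The geometric sum of the moves is written as a telescoping difference, which makes the induction
   on [n] immediate. *)
have dist m n : (m <= n)%N ->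
    nrm (Q (a m) - Q (a n)) <= 2 * 2^-1 ^+ m - 2 * 2^-1 ^+ n.
  elim: n => [|n IH]; first by rewrite leqn0 => /eqP ->; rewrite !subrr nrm0.
  rewrite leq_eqVlt => /predU1P[->|/IH mn]; first by rewrite !subrr nrm0.
  have dn : nrm (Q (a n) - Q (a n.+1)) <= 2^-1 ^+ n by rewrite nrmC -(linB lQ).
  by have := nrm_dist rs (Q (a m)) (Q (a n)) (Q (a n.+1)); rewrite exprS; lra.
have half_small (e : R) : 0 < e -> exists n, forall m, (n <= m)%N -> 2^-1 ^+ m <= e.
  move=> e0; have h1 : `|2^-1 : R| < 1 by rewrite ger0_norm; lra.
  have /cvgrPdist_lt/(_ _ e0)[n _ nP] := cvg_expr h1.
  exists n => m /nP /=; rewrite sub0r normrN => /ltW; apply: le_trans; exact: ler_norm.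
have /cvg_ex[y ay] : cvg ((fun n => Q (a n)) @ \oo).
  apply: (cauchy_nrm_cvg (rs := rs)) => e e0.
  have e20 : 0 < e / 2 by lra.
  have [n nP] := half_small _ e20; exists n => m nm.
  apply: le_trans (dist _ _ nm) _; have := nP n (leqnn n); have := half_gt0 m; lra.
have y1 : nrm y <= 1.
  rewrite -[y]subr0; apply: cvg_nrm_le ay _; exists 0%N => n _.
  by rewrite subr0; case: (ga n).
have lu := Gu.1.1.
have Uy : 1 <= re (u y).
  apply/ler_addgt0Pr => e e0; have e20 : 0 < e / 2 by lra.
  have [n nP] := half_small _ e20; have [m mP] := cvg_nrm rs ay e20.
  have := mP _ (leq_maxr n m); have := nP _ (leq_maxl n m); set k := maxn n m => hk yk.
  have [_ dk _] := dP k; have [_ Uk] := ga k.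
  have := re_le_nrm rs (u (Q (a k) - y)).
  have := nrm_le_dnrm rs (Q (a k) - y) Gu.1; rewrite du mul1r (nrmC rs (Q _) y).
  have -> : re (u (Q (a k) - y)) = re (u (a k)) - re (u y).
    have := reD rs (u (Q (a k) - y)) (u y); rewrite -(linD lu) subrK uQ//; lra.
  lra.
have uy1 : nrm (u y) = 1.
  apply/eqP; rewrite eq_le (le_trans Uy (re_le_nrm _ _)) andbT.
  by apply: le_trans (nrm_le_dnrm _ _ Gu.1) _; rewrite du mul1r.
exists y.
  rewrite -(inj_nrm rs) (_ : nrm y = 1) ?rmorph1//; apply/eqP; rewrite eq_le y1 /= -uy1.
  by apply: le_trans (nrm_le_dnrm _ _ Gu.1) _; rewrite du mul1r.
(* A scalar whose real part equals its modulus is that modulus, so [u y] is exactly [1] also over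
   the complex numbers. *)
have -> : u y = `|u y|.
  apply: (re_eq_norm (r0 := rs)); apply/eqP; rewrite eq_le re_le_norm /=.
  by have := Uy; rewrite -uy1.
by rewrite -(inj_nrm rs (u y)) uy1 rmorph1.
Qed.

Lemma invariant_dual_norm_attaining : (exists x : X, x != 0) ->
  compact_isometry_group G -> dual_G_SSD G ->
  invariant_dual G `<=` @norm_attaining K X.
Proof.
move=> [x0 x00] cG ssd f Gf; split; first exact: Gf.1.
(* The zero functional attains its norm at any unit vector, here the normalized [x0]; any other [f]
   is divided by its norm. *)
have [f0|f0] := eqVneq (dual_norm f) 0.
  exists (`|x0|^-1 *: x0); rewrite normrZ normfV normr_id mulVf ?normr_eq0//.
  split=> //; rewrite f0; apply: (nrm_eq0 (rs := rs)); apply/eqP.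
  rewrite eq_le nrm_ge0 andbT; apply: le_trans (nrm_le_dnrm _ _ Gf.1) _.
  by rewrite /real_dual_norm f0 -(rmorph0 inj) re_inj mul0r.
have fp : 0 < dnrm f.
  by rewrite -(inj_gt0 rs) inj_dnrm ?lt_def ?f0 ?(dual_norm_ge0 rs)//; exact: Gf.1.
(* The summand [0] gives [u] the shape expected by [dual_spaceDZ]. *)
pose u : X -> K^o := 0 + inj (dnrm f)^-1 *: f.
have uE x : u x = inj (dnrm f)^-1 * f x by rewrite /u add0r.
have d0 : dual_space (0 : X -> K^o).
  apply/(dual_spaceP rs); split=> [k x y|]; first by rewrite scaler0 addr0.
  by exists 0 => x; rewrite nrm0 mul0r.
have Gu : invariant_dual G u.
  split; first by apply: (dual_spaceDZ rs) => //; exact: Gf.1.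
  by move=> g x Gg; rewrite !uE Gf.2.
have fV : 0 < (dnrm f)^-1 by rewrite invr_gt0.
have nu x : nrm (u x) = (dnrm f)^-1 * nrm (f x) by rewrite uE -nrmZ// ltW.
have u1 : dual_norm u = 1.
  rewrite -(inj_dnrm rs Gu.1); apply/eqP; rewrite -(rmorph1 inj) (inj_eq (fmorph_inj inj)).
  rewrite eq_le; apply/andP; split.
    apply: dnrm_le => [|x x1]; first exact: Gu.1.
    apply: le_trans (re_le_nrm _ _) _; rewrite nu ler_pdivrMl// mulr1.
    apply: le_trans (nrm_le_dnrm _ _ Gf.1) _.
    by rewrite -[leRHS]mulr1 ler_wpM2l// ltW.
  rewrite -(ler_pM2l fp) mulr1; apply: dnrm_le => [|x x1]; first exact: Gf.1.
  apply: le_trans (re_le_nrm _ _) _; rewrite -ler_pdivrMl// -nu.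
  apply: le_trans (nrm_le_dnrm _ _ Gu.1) _.
  by rewrite -[leRHS]mulr1 ler_wpM2l// dnrm_ge0//; exact: Gu.1.
have [y yn uy] := unit_invariant_attains cG ssd Gu u1.
exists y; split=> //; move: uy; rewrite uE -(inj_dnrm rs Gf.1) => uy.
have -> : f y = inj (dnrm f) * (inj (dnrm f)^-1 * f y).
  by rewrite mulrA -rmorphM divff ?gt_eqF// rmorph1 mul1r.
by rewrite uy mulr1.
Qed.

End NormAttaining.

Theorem corollary43 (R : realType) :
  (forall (X : completeNormedModType R) (G : set (X -> X)),
      (exists x : X, x != 0) ->
      compact_isometry_group G -> dual_G_SSD G ->
      invariant_dual G `<=` @norm_attaining R X) /\
  (forall (X : completeNormedModType R[i]) (G : set (X -> X)),
      (exists x : X, x != 0) ->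
      compact_isometry_group G -> dual_G_SSD G ->
      invariant_dual G `<=` @norm_attaining R[i] X).
Proof.
split=> X G; first exact: invariant_dual_norm_attaining (real_real_scalars R) X G.
exact: invariant_dual_norm_attaining (complex_real_scalars R) X G.
Qed.
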